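(* For all integers $m,n\ge 1$, \begin{align*} w_{n}U_{m+1}+qw_{n-1}U_{m}&=W_{n+m},\\ u_{n}W_{m+1}+qu_{n-1}W_{m}&=W_{n+m},\\ W_{m+1}U_{n+1}+qW_{m}U_{n}&=U_{2}W_{m+n}+qU_{1}W_{m+n-1},\\ W_{m+1}W_{n+1}+qW_{m}W_{n}&=W_{2}W_{m+n}+qW_{1}W_{m+n-1}. \end{align*}
   Context: Let $H$ be the real quaternion algebra with basis $1,i,j,k$ and (non-commutative) multiplication determined by $i^2=j^2=k^2=-1$, $ij=-ji=k$, $jk=-kj=i$, $ki=-ik=j$; real scalars commute with all quaternions. Fix real numbers $p,q$. The Horadam sequence $w_n=w_n(w_0,w_1;p,q)$ has real initial values $w_0,w_1$ and satisfies $w_n=pw_{n-1}+qw_{n-2}$ for $n\ge 2$. Let $u_n=w_n(0,1;p,q)$ (the $(p,q)$-Fibonacci numbers). The Horadam quaternions are $W_n=w_n+w_{n+1}i+w_{n+2}j+w_{n+3}k$, and the $(p,q)$-Fibonacci quaternions are $U_n=u_n+u_{n+1}i+u_{n+2}j+u_{n+3}k$. *)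

(* Defs.v *)
From HB Require Import structures.
From mathcomp Require Import all_boot all_algebra.
From mathcomp Require Import reals ring.

Set Implicit Arguments.
Unset Strict Implicit.
Unset Printing Implicit Defensive.

Import GRing.Theory.
Local Open Scope ring_scope.

(* Quat a b c d stands for a + b i + c j + d k; the relations between the basis
   elements are the lemmas below. *)
Record quaternion (R : Type) := Quat { qre : R; qim : R; qjm : R; qkm : R }.

Definition quat_to_prod (R : Type) (x : quaternion R) : R * R * R * R :=
  (qre x, qim x, qjm x, qkm x).
Definition quat_of_prod (R : Type) (x : R * R * R * R) : quaternion R :=
  Quat x.1.1.1 x.1.1.2 x.1.2 x.2.
Lemma quat_to_prodK (R : Type) : cancel (@quat_to_prod R) (@quat_of_prod R).
Proof. by case. Qed.

HB.instance Definition _ (R : choiceType) :=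
  Choice.copy (quaternion R) (can_type (@quat_to_prodK R)).

Section QuaternionAlgebra.
Variable R : comNzRingType.
Implicit Types (x y z : quaternion R) (a b : R).

Definition quat_zero : quaternion R := Quat 0 0 0 0.
Definition quat_one : quaternion R := Quat 1 0 0 0.
Definition quat_opp x := Quat (- qre x) (- qim x) (- qjm x) (- qkm x).
Definition quat_add x y :=
  Quat (qre x + qre y) (qim x + qim y) (qjm x + qjm y) (qkm x + qkm y).
Definition quat_mul x y :=
  Quat (qre x * qre y - qim x * qim y - qjm x * qjm y - qkm x * qkm y)
       (qre x * qim y + qim x * qre y + qjm x * qkm y - qkm x * qjm y)
       (qre x * qjm y - qim x * qkm y + qjm x * qre y + qkm x * qim y)
       (qre x * qkm y + qim x * qjm y - qjm x * qim y + qkm x * qre y).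
Definition quat_scale a x := Quat (a * qre x) (a * qim x) (a * qjm x) (a * qkm x).

Lemma quat_addA : associative quat_add.
Proof. by move=> [????] [????] [????]; congr Quat; rewrite /=; ring. Qed.
Lemma quat_addC : commutative quat_add.
Proof. by move=> [????] [????]; congr Quat; rewrite /=; ring. Qed.
Lemma quat_add0 : left_id quat_zero quat_add.
Proof. by move=> [????]; congr Quat; rewrite /=; ring. Qed.
Lemma quat_addN : left_inverse quat_zero quat_opp quat_add.
Proof. by move=> [????]; congr Quat; rewrite /=; ring. Qed.

HB.instance Definition _ := GRing.isZmodule.Build (quaternion R)
  quat_addA quat_addC quat_add0 quat_addN.

Lemma quat_mulA : associative quat_mul.
Proof. by move=> [????] [????] [????]; congr Quat; rewrite /=; ring. Qed.
Lemma quat_mul1l : left_id quat_one quat_mul.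
Proof. by move=> [????]; congr Quat; rewrite /=; ring. Qed.
Lemma quat_mul1r : right_id quat_one quat_mul.
Proof. by move=> [????]; congr Quat; rewrite /=; ring. Qed.
Lemma quat_mulDl : left_distributive quat_mul quat_add.
Proof. by move=> [????] [????] [????]; congr Quat; rewrite /=; ring. Qed.
Lemma quat_mulDr : right_distributive quat_mul quat_add.
Proof. by move=> [????] [????] [????]; congr Quat; rewrite /=; ring. Qed.
Lemma quat_one_neq0 : quat_one != 0.
Proof. by apply/eqP=> -[] /eqP; rewrite oner_eq0. Qed.

HB.instance Definition _ := GRing.Zmodule_isNzRing.Build (quaternion R)
  quat_mulA quat_mul1l quat_mul1r quat_mulDl quat_mulDr quat_one_neq0.

Lemma quat_scaleA a b x : quat_scale a (quat_scale b x) = quat_scale (a * b) x.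
Proof. by case: x => ????; congr Quat; rewrite /=; ring. Qed.
Lemma quat_scale1 : left_id 1 quat_scale.
Proof. by move=> [????]; congr Quat; rewrite /=; ring. Qed.
Lemma quat_scaleDr : right_distributive quat_scale +%R.
Proof. by move=> ? [????] [????]; congr Quat; rewrite /=; ring. Qed.
Lemma quat_scaleDl x : {morph quat_scale^~ x : a b / a + b}.
Proof. by case: x => ???? ??; congr Quat; rewrite /=; ring. Qed.

HB.instance Definition _ := GRing.Zmodule_isLmodule.Build R (quaternion R)
  quat_scaleA quat_scale1 quat_scaleDr quat_scaleDl.

Lemma quat_scaleAl a x y : a *: (x * y) = (a *: x) * y.
Proof. by case: x y => [????] [????]; congr Quat; rewrite /=; ring. Qed.
Lemma quat_scaleAr a x y : a *: (x * y) = x * (a *: y).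
Proof. by case: x y => [????] [????]; congr Quat; rewrite /=; ring. Qed.

HB.instance Definition _ :=
  GRing.Lmodule_isLalgebra.Build R (quaternion R) quat_scaleAl.
HB.instance Definition _ :=
  GRing.Lalgebra_isAlgebra.Build R (quaternion R) quat_scaleAr.

Definition quat_i : quaternion R := Quat 0 1 0 0.
Definition quat_j : quaternion R := Quat 0 0 1 0.
Definition quat_k : quaternion R := Quat 0 0 0 1.

Lemma quatE (a b c d : R) :
  Quat a b c d = a *: 1 + b *: quat_i + c *: quat_j + d *: quat_k.
Proof. by congr Quat; rewrite /=; ring. Qed.

Lemma quat_sqr :
  [/\ quat_i * quat_i = -1, quat_j * quat_j = -1 & quat_k * quat_k = -1].
Proof. by split; congr Quat; rewrite /=; ring. Qed.
Lemma quat_ij : quat_i * quat_j = quat_k /\ quat_j * quat_i = - quat_k.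
Proof. by split; congr Quat; rewrite /=; ring. Qed.
Lemma quat_jk : quat_j * quat_k = quat_i /\ quat_k * quat_j = - quat_i.
Proof. by split; congr Quat; rewrite /=; ring. Qed.
Lemma quat_ki : quat_k * quat_i = quat_j /\ quat_i * quat_k = - quat_j.
Proof. by split; congr Quat; rewrite /=; ring. Qed.

End QuaternionAlgebra.

Arguments quat_i {R}.
Arguments quat_j {R}.
Arguments quat_k {R}.

(* w_n(w0, w1; p, q) *)
Fixpoint horadam (R : realType) (w0 w1 p q : R) (n : nat) : R :=
  match n with
  | 0%N => w0
  | n'.+1 =>
    match n' with
    | 0%N => w1
    | n''.+1 => p * horadam w0 w1 p q n' + q * horadam w0 w1 p q n''
    end
  end.

Definition fib_pq (R : realType) (p q : R) (n : nat) : R := horadam 0 1 p q n.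

Definition seq_quat (R : realType) (s : nat -> R) (n : nat) : quaternion R :=
  s n *: 1 + s (n + 1)%N *: quat_i + s (n + 2)%N *: quat_j + s (n + 3)%N *: quat_k.

Definition horadam_quat (R : realType) (w0 w1 p q : R) (n : nat) : quaternion R :=
  seq_quat (horadam w0 w1 p q) n.

Definition fib_pq_quat (R : realType) (p q : R) (n : nat) : quaternion R :=
  seq_quat (fib_pq p q) n.

(* Main.v *)
Require Import Defs.
From HB Require Import structures.
From mathcomp Require Import all_boot all_algebra.
From mathcomp Require Import reals.
From mathcomp Require Import ring zify.

Set Implicit Arguments.
Unset Strict Implicit.
Unset Printing Implicit Defensive.

Import GRing.Theory.
Local Open Scope ring_scope.

(** If x and y both satisfy s_(n+2) = p s_(n+1) + q s_n, the bilinear form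
    B(i, j) = x_(i+1) y_(j+1) + q x_i y_j satisfies B(i+1, j) = B(i, j+1), so it
    depends only on i + j, and it does not change when x and y are exchanged.
    The coefficients of X_(m+1) Y_(n+1) + q X_m Y_n on the products of basis
    elements are values of B, so the two quaternion factors may be exchanged if
    the sum of their indices is kept, although quaternions do not commute.
    For x = u one has B(0, j) = y_(j+1), which gives the first two identities. *)

Definition horadam_rec (R : pzRingType) (p q : R) (s : nat -> R) :=
  forall n, s n.+2 = p * s n.+1 + q * s n.

Definition horadam_form (R : pzRingType) (q : R) (x y : nat -> R) (i j : nat) :=
  x i.+1 * y j.+1 + q * (x i * y j).

Lemma horadam_formC (R : comPzRingType) (q : R) x y i j :
  horadam_form q x y i j = horadam_form q y x j i.
Proof. by rewrite /horadam_form [x i * _]mulrC [x i.+1 * _]mulrC. Qed.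

(** Expanding [x i.+2] in B(i+1, j) and [y j.+2] in B(i, j+1) gives the same p x_(i+1) y_(j+1) + q
    (x_i y_(j+1) + x_(i+1) y_j). *)
Lemma horadam_form0 (R : comNzRingType) (p q : R) x y i j :
    horadam_rec p q x -> horadam_rec p q y ->
  horadam_form q x y i j = horadam_form q x y 0 (i + j).
Proof.
move=> xrec yrec; elim: i j => // i IHi j.
by rewrite addSnnS -IHi /horadam_form xrec yrec; ring.
Qed.

Lemma eq_horadam_form (R : comNzRingType) (p q : R) x y i j i' j' :
    horadam_rec p q x -> horadam_rec p q y -> (i + j = i' + j')%N ->
  horadam_form q x y i j = horadam_form q y x i' j'.
Proof.
move=> xrec yrec eq_ij; rewrite (@horadam_form0 _ p) // eq_ij.
by rewrite [RHS]horadam_formC [RHS](@horadam_form0 _ p) // addnC.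
Qed.

Lemma horadamP (R : realType) (w0 w1 p q : R) :
  horadam_rec p q (horadam w0 w1 p q).
Proof. by []. Qed.

Lemma fib_pqP (R : realType) (p q : R) : horadam_rec p q (fib_pq p q).
Proof. by []. Qed.

Lemma horadam_form_fib (R : realType) (p q : R) y i j :
  horadam_rec p q y -> horadam_form q (fib_pq p q) y i j = y (i + j).+1.
Proof.
move=> yrec; rewrite (horadam_form0 _ _ (fib_pqP p q) yrec).
by rewrite /horadam_form /fib_pq /= mul1r mul0r mulr0 addr0.
Qed.

Lemma seq_quatE (R : realType) (s : nat -> R) n :
  seq_quat s n = Quat (s n) (s n.+1) (s n.+2) (s n.+3).
Proof. by rewrite quatE /seq_quat addn1 addn2 addn3. Qed.

Lemma scale_fib_seq_quat (R : realType) (p q : R) y i j : horadam_rec p q y ->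
  fib_pq p q i.+1 *: seq_quat y j.+1 + (q * fib_pq p q i) *: seq_quat y j
  = seq_quat y (i + j).+1.
Proof.
move=> yrec; rewrite !seq_quatE.
(* The component of index c = 0, ..., 3 is the form at (i, j + c). *)
by congr Quat; rewrite /= -mulrA -/(horadam_form q _ y i _)
  (@horadam_form_fib _ p) // ?addnS.
Qed.

Lemma scale_seq_quat_fib (R : realType) (p q : R) y i j : horadam_rec p q y ->
  y i.+1 *: seq_quat (fib_pq p q) j.+1
    + (q * y i) *: seq_quat (fib_pq p q) j
  = seq_quat y (i + j).+1.
Proof.
move=> yrec; rewrite !seq_quatE.
(* Here [fib_pq] stands second, so the form is flipped before [horadam_form_fib] applies. *)
by congr Quat; rewrite /= -mulrA -/(horadam_form q y _ i _) horadam_formC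
  (@horadam_form_fib _ p) // addnC ?addnS.
Qed.

Lemma seq_quat_mul (R : realType) (p q : R) x y i j i' j' :
    horadam_rec p q x -> horadam_rec p q y -> (i + j = i' + j')%N ->
  seq_quat x i.+1 * seq_quat y j.+1 + q *: (seq_quat x i * seq_quat y j)
  = seq_quat y i'.+1 * seq_quat x j'.+1
    + q *: (seq_quat y i' * seq_quat x j').
Proof.
move=> xrec yrec eq_ij.
(* Number 1, i, j, k from 0 to 3: [B a b] is the coefficient of the product of basis elements a and
   b on the left-hand side, and [B' a b] on the right-hand side. *)
pose B a b := horadam_form q x y (a + i) (b + j).
pose B' a b := horadam_form q y x (a + i') (b + j').
have eqB a b : B a b = B' a b by apply: (@eq_horadam_form _ p) => //; lia.
rewrite !seq_quatE; congr Quat => /=.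
(* The signs in each component are those of the quaternion multiplication table, the same on both
   sides. *)
- transitivity (B 0%N 0%N - B 1%N 1%N - B 2%N 2%N - B 3%N 3%N);
    first by rewrite /B /horadam_form /=; ring.
  by rewrite !eqB /B' /horadam_form /=; ring.
- transitivity (B 0%N 1%N + B 1%N 0%N + B 2%N 3%N - B 3%N 2%N);
    first by rewrite /B /horadam_form /=; ring.
  by rewrite !eqB /B' /horadam_form /=; ring.
- transitivity (B 0%N 2%N - B 1%N 3%N + B 2%N 0%N + B 3%N 1%N);
    first by rewrite /B /horadam_form /=; ring.
  by rewrite !eqB /B' /horadam_form /=; ring.
- transitivity (B 0%N 3%N + B 1%N 2%N - B 2%N 1%N + B 3%N 0%N);
    first by rewrite /B /horadam_form /=; ring.
  by rewrite !eqB /B' /horadam_form /=; ring.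
Qed.

Theorem theorem2p2 (R : realType) (p q w0 w1 : R) (m n : nat)
    (hm : (1 <= m)%N) (hn : (1 <= n)%N) :
  let w := horadam w0 w1 p q in
  let u := fib_pq p q in
  let W := horadam_quat w0 w1 p q in
  let U := fib_pq_quat p q in
  [/\ w n *: U (m + 1)%N + (q * w (n - 1)%N) *: U m = W (n + m)%N,
      u n *: W (m + 1)%N + (q * u (n - 1)%N) *: W m = W (n + m)%N,
      W (m + 1)%N * U (n + 1)%N + q *: (W m * U n)
        = U 2%N * W (m + n)%N + q *: (U 1%N * W (m + n - 1)%N)
    & W (m + 1)%N * W (n + 1)%N + q *: (W m * W n)
        = W 2%N * W (m + n)%N + q *: (W 1%N * W (m + n - 1)%N)].
Proof.
move=> w u W U; case: n hn => // n _.
rewrite !addn1 !addnS !subn1 /= addSn.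
have wrec := horadamP w0 w1 p q; have urec := fib_pqP p q.
split.
- exact: scale_seq_quat_fib.
- exact: scale_fib_seq_quat.
(* Now [n.+1] is the original n; the index pair (m, n + 1) is traded for (1, m + n). *)
- by apply: (@seq_quat_mul _ p) => //; rewrite addnS.
- by apply: (@seq_quat_mul _ p) => //; rewrite addnS.
Qed.
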